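(* Every $\ell_\infty$-embeddable algebra or Banach space is $(\ell_\infty\setminus c)$-embeddable.
   Context: All algebras are associative and complex; $\ell_\infty$ is the $C^*$-algebra of bounded complex sequences and $c$ the subalgebra of convergent sequences. Let $B$ be a $C^*$-algebra. A $B$-embedding of $A$ is an injective linear map $\phi\colon A\to B$ preserving the structure of $A$: isometric if $A$ is a Banach space; an algebra homomorphism if $A$ is an algebra; isometric and an algebra homomorphism if $A$ is a Banach algebra; a $^*$-homomorphism if $A$ is a $C^*$-algebra. $A$ is $B$-embeddable if a $B$-embedding of $A$ exists. For $Y\subset B$, $A$ is $(B\setminus Y)$-embeddable if there is a $B$-embedding $\phi$ of $A$ with $\phi(A)\cap Y=\{0\}$. *)

(* Defs.v *)
From HB Require Import structures.
From mathcomp Require Import all_boot all_order all_algebra complex.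
From mathcomp Require Import all_classical all_reals all_analysis.
From mathcomp Require Import lra.
Set Implicit Arguments.
Unset Strict Implicit.
Unset Printing Implicit Defensive.
Import Order.TTheory GRing.Theory Num.Theory numFieldNormedType.Exports.
Local Open Scope classical_set_scope.
Local Open Scope ring_scope.

(* Associative algebras need not have a unit, so the library's [algType], whose
   multiplication is unital (and whose morphisms preserve the unit), does not
   apply. *)
HB.mixin Record Lmodule_isNuAlgebra (K : pzRingType) A & GRing.Lmodule K A := {
  amul : A -> A -> A;
  amulA : associative amul;
  amulDl : left_distributive amul +%R;
  amulDr : right_distributive amul +%R;
  amulZl : forall (k : K) (x y : A), amul (k *: x) y = k *: amul x y;
  amulZr : forall (k : K) (x y : A), amul x (k *: y) = k *: amul x y
}.

#[short(type="nuAlgType")]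
HB.structure Definition NuAlgebra (K : pzRingType) :=
  {A of GRing.Lmodule K A & Lmodule_isNuAlgebra K A}.

HB.mixin Record isSubmultiplicative (K : numFieldType) A
    & CompleteNormedModule K A & NuAlgebra K A := {
  anormM : forall x y : A, `|amul x y| <= `|x| * `|y|
}.

#[short(type="banachAlgType")]
HB.structure Definition BanachAlgebra (K : numFieldType) :=
  {A of CompleteNormedModule K A & NuAlgebra K A & isSubmultiplicative K A}.

HB.mixin Record BanachAlgebra_isCStar (K : numClosedFieldType) A
    & BanachAlgebra K A := {
  star : A -> A;
  starK : involutive star;
  starD : {morph star : x y / x + y};
  starZ : forall (k : K) (x : A), star (k *: x) = k^* *: star x;
  starM : forall x y : A, star (amul x y) = amul (star y) (star x);
  cstar_norm : forall x : A, `|amul (star x) x| = `|x| ^+ 2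
}.

#[short(type="cstarAlgType")]
HB.structure Definition CStarAlgebra (K : numClosedFieldType) :=
  {A of BanachAlgebra K A & BanachAlgebra_isCStar K A}.

Section Embeddings.
Variable K : numClosedFieldType.

Definition isometric (A B : normedModType K) (phi : A -> B) :=
  forall x, `|phi x| = `|x|.

Definition multiplicative_map (A B : nuAlgType K) (phi : A -> B) :=
  {morph phi : x y / amul x y}.

Definition star_preserving (A B : cstarAlgType K) (phi : A -> B) :=
  {morph phi : x / star x}.

Definition algebra_embedding (A : nuAlgType K) (B : cstarAlgType K)
    (phi : {linear A -> B}) :=
  injective phi /\ multiplicative_map phi.

Definition banach_space_embedding (A : completeNormedModType K)
    (B : cstarAlgType K) (phi : {linear A -> B}) :=
  injective phi /\ isometric phi.

Definition banach_algebra_embedding (A : banachAlgType K)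
    (B : cstarAlgType K) (phi : {linear A -> B}) :=
  [/\ injective phi, isometric phi & multiplicative_map phi].

Definition cstar_algebra_embedding (A B : cstarAlgType K)
    (phi : {linear A -> B}) :=
  [/\ injective phi, multiplicative_map phi & star_preserving phi].

(* Which maps count as embeddings depends on the kind of structure [A] is
   regarded as carrying; this is the parameter [emb]. *)
Definition embeddable (A : lmodType K) (B : cstarAlgType K)
    (emb : {linear A -> B} -> Prop) :=
  exists phi : {linear A -> B}, emb phi.

Definition embeddable_off (A : lmodType K) (B : cstarAlgType K)
    (emb : {linear A -> B} -> Prop) (Y : set B) :=
  exists phi : {linear A -> B}, emb phi /\ range phi `&` Y = [set 0].

End Embeddings.

Arguments algebra_embedding {K} A B phi.
Arguments banach_space_embedding {K} A B phi.
Arguments banach_algebra_embedding {K} A B phi.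
Arguments cstar_algebra_embedding {K} A B phi.

Section EllInfty.
Variable R : realType.
(* The library equips [R[i]^o], not [R[i]], with the topology of the modulus. *)
Local Notation C := (R[i]^o).
Local Notation normc := (@Normc.normc R).
Local Notation "r %:C" := (real_complex R r).

Definition bounded_seq : {pred nat -> C} :=
  fun u => `[< [bounded u n | n in [set: nat]] >].

Lemma norm_normc (z : C) : `|z| = (normc z)%:C. Proof. by []. Qed.

Lemma normc_ge0 z : 0 <= normc z.
Proof. by rewrite -lecR -norm_normc normr_ge0. Qed.
#[local] Hint Resolve normc_ge0 : core.

Let normc_le_ReIm z : normc z <= `|complex.Re z| + `|complex.Im z|.
Proof.
rewrite -(ler_pXn2r (n := 2)) ?nnegrE ?addr_ge0 ?normc_ge0//.
case: z => a b /=; rewrite sqr_sqrtr ?addr_ge0 ?sqr_ge0//.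
rewrite sqrrD !real_normK ?num_real// lerD2r lerDl.
by rewrite mulrn_wge0// mulr_ge0.
Qed.

Let Re_le_normc z : `|complex.Re z| <= normc z.
Proof.
rewrite -(ler_pXn2r (n := 2)) ?nnegrE ?normc_ge0//.
case: z => a b /=; rewrite sqr_sqrtr ?addr_ge0 ?sqr_ge0//.
by rewrite real_normK ?num_real// lerDl sqr_ge0.
Qed.

Let Im_le_normc z : `|complex.Im z| <= normc z.
Proof.
rewrite -(ler_pXn2r (n := 2)) ?nnegrE ?normc_ge0//.
case: z => a b /=; rewrite sqr_sqrtr ?addr_ge0 ?sqr_ge0//.
by rewrite real_normK ?num_real// lerDr sqr_ge0.
Qed.

Lemma bounded_seqP (u : nat -> C) :
  reflect (exists M : R, forall n, normc (u n) <= M) (u \in bounded_seq).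
Proof.
apply: (iffP idP).
  move=> /asboolP/(@ex_bound _ _ _ _ _ (globally_properfilter (I : setT 0%N))).
  move=> [M /= uM]; exists (complex.Re M) => n; have := uM n I.
  by rewrite norm_normc lecE/= => /andP[].
move=> [M uM]; apply/asboolP.
apply/(@ex_bound _ _ _ _ _ (globally_properfilter (I : setT 0%N))); exists (M%:C) => n _.
by rewrite /= norm_normc lecR.
Qed.

Let bounded_seq_submod : submod_closed bounded_seq.
Proof.
split.
  by apply/bounded_seqP; exists 0 => n; rewrite Normc.normc0.
move=> k u v /bounded_seqP[M uM] /bounded_seqP[N vN]; apply/bounded_seqP.
exists (normc k * M + N) => n.
rewrite (le_trans (le_normcD _ _))// lerD//.
by rewrite (_ : (k *: u) n = k * u n)// Normc.normcM ler_wpM2l.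
Qed.

HB.instance Definition _ :=
  GRing.isSubmodClosed.Build _ _ bounded_seq bounded_seq_submod.

Record linfty := LInfty {
  linfty_val :> nat -> C;
  _ : linfty_val \in bounded_seq
}.

HB.instance Definition _ := [isSub for linfty_val].
HB.instance Definition _ := [Choice of linfty by <:].
HB.instance Definition _ := [SubChoice_isSubLmodule of linfty by <:].

Implicit Types (x y : linfty) (k : R[i]).

Lemma linftyD x y n : (x + y) n = x n + y n. Proof. by []. Qed.
Lemma linftyN x n : (- x) n = - x n. Proof. by []. Qed.
Lemma linftyZ k x n : (k *: x) n = k * x n. Proof. by []. Qed.

Lemma linfty_eq x y : (forall n, x n = y n) -> x = y.
Proof. by move=> xy; apply/val_inj/funext. Qed.

Definition sup_norm x : R := sup (range (fun n => normc (x n))).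

Lemma normc_has_sup x : has_sup (range (fun n => normc (x n))).
Proof.
split; first by exists (normc (x 0)), 0%N.
have /bounded_seqP[M xM] := valP x.
by exists M => _ [n _ <-]; exact: xM.
Qed.

Lemma le_sup_norm x n : normc (x n) <= sup_norm x.
Proof. by apply: ub_le_sup; [case: (normc_has_sup x)|exists n]. Qed.

Lemma sup_norm_le x M : (forall n, normc (x n) <= M) -> sup_norm x <= M.
Proof.
by move=> xM; apply: ge_sup; [case: (normc_has_sup x)|move=> _ [n _ <-]].
Qed.

Lemma sup_norm_ge0 x : 0 <= sup_norm x.
Proof. exact: le_trans (le_sup_norm x 0). Qed.
#[local] Hint Resolve le_sup_norm sup_norm_ge0 : core.

Let ler_sup_normD x y :
  (sup_norm (x + y))%:C <= (sup_norm x)%:C + (sup_norm y)%:C.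
Proof.
rewrite -rmorphD lecR; apply: sup_norm_le => n.
by rewrite linftyD (le_trans (le_normcD _ _))// lerD.
Qed.

Let sup_norm0_eq0 x : (sup_norm x)%:C = 0 -> x = 0.
Proof.
move=> [x0]; apply: linfty_eq => n; apply: Normc.eq0_normc; apply/eqP.
by rewrite eq_le normc_ge0 andbT -x0.
Qed.

Let sup_normZ k x : (sup_norm (k *: x))%:C = `|k| * (sup_norm x)%:C.
Proof.
rewrite (norm_normc k) -rmorphM; congr (_%:C); apply/eqP.
rewrite eq_le; apply/andP; split.
  by apply: sup_norm_le => n; rewrite linftyZ Normc.normcM ler_wpM2l.
have [->|k0] := eqVneq k 0; first by rewrite Normc.normc0 mul0r.
have nk : 0 < normc k.
  by rewrite lt_def normc_ge0 andbT; apply: contra_neq k0 => /Normc.eq0_normc.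
rewrite mulrC -ler_pdivlMr//; apply: sup_norm_le => n.
by rewrite ler_pdivlMr// mulrC -Normc.normcM -linftyZ.
Qed.

HB.instance Definition _ := Lmodule_isNormed.Build R[i] linfty
  ler_sup_normD sup_normZ sup_norm0_eq0.

Lemma norm_linfty x : `|x| = (sup_norm x)%:C. Proof. by []. Qed.

Let ball_linfty x y (e : R) : ball x e%:C y <-> sup_norm (x - y) < e.
Proof. by rewrite -ball_normE /ball_/= norm_linfty ltcR. Qed.

Let linfty_complete (F : set_system linfty) :
  ProperFilter F -> cauchy F -> cvg F.
Proof.
move=> FF /cauchyP Fc.
have Fball (e : R) : 0 < e ->
    exists x, F [set y | forall n, normc (x n - y n) < e].
  rewrite -ltcR => /Fc[x xe]; exists x; apply: filterS xe => y /ball_linfty xy n.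
  exact: le_lt_trans (le_sup_norm (x - y) n) xy.
have Fp (p : {additive R[i] -> R}) : (forall z, `|p z| <= normc z) ->
    exists l : nat -> R, forall (e : R) x n, 0 < e ->
      F [set y | forall n, normc (x n - y n) < e] -> `|p (x n) - l n| <= e *+ 2.
  move=> pn; have cvp n : cvg (p (y n) @[y --> F]).
    apply: R_complete; apply: cauchy_exP => e /Fball[x xe].
    exists (p (x n)); rewrite /fmap/=; apply: filterS xe => y /(_ n) xy.
    by rewrite -ball_normE/= -raddfB (le_lt_trans (pn _)).
  exists (fun n => lim (p (y n) @[y --> F])) => e x n e0 xe.
  have /cvgr_dist_lt/(_ _ e0) le := cvp n.
  have [y [xy ly]] := filter_ex (filterI xe le).
  rewrite -(subrKA (p (y n))) mulr2n (le_trans (ler_normD _ _))// lerD//.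
    by rewrite -raddfB (le_trans (pn _))// ltW.
  by rewrite distrC ltW.
have [lr lrP] := Fp (@complex.Re R) Re_le_normc.
have [li liP] := Fp (@complex.Im R) Im_le_normc.
pose l n : C := Complex (lr n) (li n).
have lP (e : R) x n : 0 < e -> F [set y | forall n, normc (x n - y n) < e] ->
    normc (x n - l n) <= e *+ 4.
  move=> e0 xe; rewrite (le_trans (normc_le_ReIm _))//.
  rewrite (mulrnDr e 2 2) lerD//; rewrite raddfB; [exact: lrP|exact: liP].
have lb : l \in bounded_seq.
  have [x xe] := Fball _ ltr01; apply/bounded_seqP.
  exists (sup_norm x + 1 *+ 4) => n.
  rewrite -[l n](subKr (x n)) (le_trans (le_normcD _ _))// lerD//.
  by rewrite normcN; exact: lP.
apply/cvg_ex; exists (LInfty lb); apply/fcvg_ballP => e e0.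
have -> : e = (complex.Re e)%:C by rewrite RRe_real// gtr0_real.
have {e0} : 0 < complex.Re e by move: e0; rewrite ltcE => /andP[].
move: (complex.Re e) => {}e e0.
have e8 : 0 < e / 8 by rewrite divr_gt0.
have [x xe] := Fball _ e8; apply: filterS (xe) => y xy; apply/ball_linfty.
apply: (@le_lt_trans _ _ (e / 8 *+ 5)); last first.
  by rewrite -mulr_natr; lra.
apply: sup_norm_le => n; rewrite -[X in normc X]/(l n - y n) -(subrKA (x n)).
rewrite (le_trans (le_normcD _ _))// (mulrnDr _ 4 1) lerD//; last exact: ltW.
by rewrite -normcN opprB; exact: lP.
Qed.

HB.instance Definition _ := Uniform_isComplete.Build linfty linfty_complete.

Let linfty_mul_subproof x y : (fun n => x n * y n) \in bounded_seq.
Proof.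
apply/bounded_seqP; exists (sup_norm x * sup_norm y) => n.
by rewrite Normc.normcM ler_pM.
Qed.

Definition linfty_mul x y := LInfty (linfty_mul_subproof x y).

Let linfty_mulA : associative linfty_mul.
Proof. by move=> x y z; apply: linfty_eq => n; exact: mulrA. Qed.

Let linfty_mulDl : left_distributive linfty_mul +%R.
Proof. by move=> x y z; apply: linfty_eq => n; exact: mulrDl. Qed.

Let linfty_mulDr : right_distributive linfty_mul +%R.
Proof. by move=> x y z; apply: linfty_eq => n; exact: mulrDr. Qed.

Let linfty_mulZl k x y : linfty_mul (k *: x) y = k *: linfty_mul x y.
Proof. by apply: linfty_eq => n; rewrite linftyZ/=; exact: esym (mulrA _ _ _). Qed.

Let linfty_mulZr k x y : linfty_mul x (k *: y) = k *: linfty_mul x y.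
Proof. by apply: linfty_eq => n; rewrite linftyZ/=; exact: mulrCA. Qed.

HB.instance Definition _ := Lmodule_isNuAlgebra.Build R[i] linfty
  linfty_mulA linfty_mulDl linfty_mulDr linfty_mulZl linfty_mulZr.

Let linfty_normM x y : `|amul x y| <= `|x| * `|y|.
Proof.
rewrite !norm_linfty -rmorphM lecR; apply: sup_norm_le => n.
by rewrite Normc.normcM ler_pM.
Qed.

HB.instance Definition _ := isSubmultiplicative.Build R[i] linfty linfty_normM.

Let normcJ (z : R[i]) : normc z^* = normc z.
Proof. by case: z => a b /=; rewrite sqrrN. Qed.

Let linfty_star_subproof x : (fun n => (x n)^*) \in bounded_seq.
Proof. by apply/bounded_seqP; exists (sup_norm x) => n; rewrite normcJ. Qed.

Definition linfty_star x := LInfty (linfty_star_subproof x).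

Let linfty_starK : involutive linfty_star.
Proof. by move=> x; apply: linfty_eq => n; exact: conjCK. Qed.

Let linfty_starD : {morph linfty_star : x y / x + y}.
Proof. by move=> x y; apply: linfty_eq => n; exact: rmorphD. Qed.

Let linfty_starZ k x : linfty_star (k *: x) = k^* *: linfty_star x.
Proof. by apply: linfty_eq => n; exact: rmorphM. Qed.

Let linfty_starM x y :
  linfty_star (amul x y) = amul (linfty_star y) (linfty_star x).
Proof. by apply: linfty_eq => n /=; rewrite rmorphM mulrC. Qed.

Let linfty_cstar_norm x : `|amul (linfty_star x) x| = `|x| ^+ 2.
Proof.
rewrite !norm_linfty -rmorphXn; congr (_%:C); apply/eqP.
rewrite eq_le; apply/andP; split.
  apply: sup_norm_le => n.
  by rewrite Normc.normcM normcJ expr2 ler_pM.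
rewrite -ler_sqrt ?sup_norm_ge0// sqrtr_sqr ger0_norm//.
apply: sup_norm_le => n.
rewrite -(ler_pXn2r (n := 2)) ?nnegrE ?sqrtr_ge0 ?normc_ge0//.
rewrite sqr_sqrtr// expr2 -{1}(normcJ (x n)) -Normc.normcM.
exact: (le_sup_norm (amul (linfty_star x) x)).
Qed.

HB.instance Definition _ := BanachAlgebra_isCStar.Build R[i] linfty
  linfty_starK linfty_starD linfty_starZ linfty_starM linfty_cstar_norm.

Definition convergent_seq : set linfty := [set x | cvgn (x : nat -> C)].

End EllInfty.

Arguments convergent_seq : clear implicits.

(* Main.v *)
Require Import Defs.
From HB Require Import structures.
From mathcomp Require Import all_boot all_order all_algebra complex.
From mathcomp Require Import all_classical all_reals all_analysis.
Import Order.TTheory GRing.Theory Num.Theory numFieldNormedType.Exports.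
Local Open Scope classical_set_scope.
Local Open Scope ring_scope.

(** The space of bounded sequences embeds into itself off the convergent ones.
    Let [spread x] be a sequence that takes the value [0] and each of the values
    [x k] at infinitely many indices, and no other value. If [spread x]
    converges, its limit is both [0] and [x k], for every [k], so [x = 0]. The
    operations and the norm of bounded sequences are computed termwise and
    [spread] only repeats terms and inserts zeros, so it is an isometric
    *-homomorphism (it does not preserve the unit: that is how it keeps
    the constant sequences out of its range). Composing any embedding with
    [spread] yields an embedding of the same kind that meets the convergent
    sequences in [0] only. *)

Section Spread.
Variable R : realType.
Implicit Types x y : linfty R.

(** Sorting the indices [n] by their 2-adic valuation splits them into
    infinitely many infinite classes: the valuation [0] is reserved for the
    zeros, and the valuation [k.+1] for the copies of [x k]. *)
Definition spread_seq (x : nat -> R[i]^o) (n : nat) : R[i]^o :=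
  if logn 2 n is k.+1 then x k else 0.

Lemma spread_seq_bounded x : spread_seq x \in @bounded_seq R.
Proof.
apply/bounded_seqP; exists (sup_norm x) => n; rewrite /spread_seq.
by case: logn => [|k]; rewrite ?Normc.normc0 ?sup_norm_ge0 ?le_sup_norm.
Qed.

Definition spread x : linfty R := LInfty (spread_seq_bounded x).

Lemma spreadE x n : spread x n = if logn 2 n is k.+1 then x k else 0.
Proof. by []. Qed.

Lemma spread_linear : linear spread.
Proof.
move=> k x y; apply: linfty_eq => n; rewrite linftyD linftyZ !spreadE.
by case: logn => [|m]; rewrite ?mulr0 ?addr0.
Qed.

HB.instance Definition _ :=
  GRing.isLinear.Build R[i] (linfty R) (linfty R) *:%R spread spread_linear.

Lemma logn2_pow23 e j : logn 2 (2 ^ e * 3 ^ j) = e.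
Proof.
rewrite lognM ?expn_gt0// pfactorK// lognX.
by rewrite (@logn_coprime 2 3)// muln0 addn0.
Qed.

Lemma spread_pow23 x k j : spread x (2 ^ k.+1 * 3 ^ j)%N = x k.
Proof. by rewrite spreadE logn2_pow23. Qed.

Lemma isometric_spread : isometric spread.
Proof.
move=> x; rewrite !norm_linfty; congr (real_complex _ _).
apply/eqP; rewrite eq_le; apply/andP; split; apply: sup_norm_le => n.
  rewrite spreadE; case: logn => [|k]; last exact: le_sup_norm.
  by rewrite Normc.normc0 sup_norm_ge0.
by rewrite -(spread_pow23 x n 0) le_sup_norm.
Qed.

Lemma injective_spread : injective spread.
Proof.
by move=> x y xy; apply: linfty_eq => k; rewrite -!(spread_pow23 _ k 0) xy.
Qed.

Lemma multiplicative_spread : multiplicative_map spread.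
Proof.
move=> x y; apply: linfty_eq => n /=; rewrite /spread_seq.
by case: logn => [|k] //=; rewrite mul0r.
Qed.

Lemma star_preserving_spread : star_preserving spread.
Proof.
move=> x; apply: linfty_eq => n /=; rewrite /spread_seq.
by case: logn => [|k] //=; rewrite rmorph0.
Qed.

Lemma cvgn_pow23 e : (2 ^ e * 3 ^ j)%N @[j --> \oo] --> \oo.
Proof.
apply/cvgnyPge => N; near=> j.
apply: (@leq_trans j); first by near: j; exact: nbhs_infty_ge.
by rewrite (leq_trans (ltnW (ltn_expl j (isT : 1 < 3)%N)))// leq_pmull ?expn_gt0.
Unshelve. all: by end_near. Qed.

(** Along [2 ^ e * 3 ^ j], with [j] varying, [spread x] is constant: equal to
    [0] for [e = 0] and to [x k] for [e = k.+1]. A limit must agree with all of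
    these constants. *)
Lemma spread_convergent x : convergent_seq R (spread x) -> x = 0.
Proof.
move=> /cvg_ex[l xl].
have lE e : l = if e is k.+1 then x k else 0.
  have cl : spread x (2 ^ e * 3 ^ j)%N @[j --> \oo] --> l.
    exact: cvg_comp (cvgn_pow23 e) xl.
  move: cl; under eq_cvg do rewrite spreadE logn2_pow23.
  move=> cl; apply: (cvg_unique _ cl); last exact: cvg_cst.
  exact: norm_hausdorff.
by apply: linfty_eq => k; rewrite -(lE k.+1) (lE 0%N).
Qed.

Lemma range_spread_convergent (A : lmodType R[i]) (phi : {linear A -> linfty R}) :
  range (spread \o phi) `&` convergent_seq R = [set 0].
Proof.
apply/seteqP; split=> [_ [[a _ <-] /spread_convergent /= ->]|_ ->].
  exact: linear0.
split; first by exists 0 => //; rewrite linear0.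
exact: (is_cvg_cst (0 : R[i]^o)).
Qed.

(** Reduces each kind of structure to the stability of its embeddings under
    composition with [spread]. *)
Lemma embeddable_off_convergent (A : lmodType R[i])
    (emb : {linear A -> linfty R} -> Prop) :
  (forall phi : {linear A -> linfty R}, emb phi -> emb (spread \o phi)) ->
  embeddable emb -> embeddable_off emb (convergent_seq R).
Proof.
move=> emb_spread [phi /emb_spread emb_phi].
by exists (spread \o phi); split; last exact: range_spread_convergent.
Qed.

End Spread.

Theorem theorem2p10 (R : realType) :
  [/\ forall A : nuAlgType R[i],
        embeddable (algebra_embedding A (linfty R)) ->
        embeddable_off (algebra_embedding A (linfty R)) (convergent_seq R),
      forall A : completeNormedModType R[i],
        embeddable (banach_space_embedding A (linfty R)) ->
        embeddable_off (banach_space_embedding A (linfty R)) (convergent_seq R),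
      forall A : banachAlgType R[i],
        embeddable (banach_algebra_embedding A (linfty R)) ->
        embeddable_off (banach_algebra_embedding A (linfty R)) (convergent_seq R)
    & forall A : cstarAlgType R[i],
        embeddable (cstar_algebra_embedding A (linfty R)) ->
        embeddable_off (cstar_algebra_embedding A (linfty R)) (convergent_seq R)].
Proof.
have inj_comp := inj_comp (@injective_spread R).
split=> A; apply: embeddable_off_convergent => phi.
- move=> [/inj_comp inj mul]; split=> // x y /=.
  by rewrite mul multiplicative_spread.
- by move=> [/inj_comp inj iso]; split=> // x; rewrite isometric_spread iso.
- move=> [/inj_comp inj iso mul]; split=> // [x|x y] /=.
    by rewrite isometric_spread iso.
  by rewrite mul multiplicative_spread.
- move=> [/inj_comp inj mul st]; split=> // [x y|x] /=.
    by rewrite mul multiplicative_spread.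
  by rewrite st star_preserving_spread.
Qed.
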